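(* Let $G$ be a finite group and let $p$ be a prime. If $d_{p'}(G)>2/(p+1)$, then $G$ has a normal Sylow $p$-subgroup.
   Context: For a finite group $G$ and prime $p$, $k_{p'}(G)$ denotes the number of conjugacy classes of elements of $G$ whose order is not divisible by $p$, $|G|_{p'}$ is the largest divisor of $|G|$ coprime to $p$, and $d_{p'}(G)=k_{p'}(G)/|G|_{p'}$. *)

(* Defs.v *)
From mathcomp Require Import all_boot all_order all_algebra all_fingroup all_solvable.
Set Implicit Arguments. Unset Strict Implicit. Unset Printing Implicit Defensive.

(* k_{p'}(G): the number of conjugacy classes of G whose elements have order
   coprime to p (orders are constant on a class, so testing the representative
   is the same as testing every element). *)
Definition kpprime (gT : finGroupType) (p : nat) (G : {set gT}) : nat :=
  #|[set xG in classes G | (p^'.-elt (repr xG))%g]|.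

Definition dpprime (gT : finGroupType) (p : nat) (G : {set gT}) : rat :=
  ((kpprime p G)%:R / (#|G|`_p^')%:R)%R.

(* Main.v *)
Require Import Defs.
From mathcomp Require Import all_boot all_order all_algebra all_fingroup all_solvable.
From mathcomp Require Import all_field all_character.

(** Let P be a Sylow p-subgroup of G. The heart of the proof is the bound
    k_{p'}(G) <= |P\G/P|. Over an algebraically closed field of characteristic p:
    - every irreducible module S embeds in the functions on the right cosets of
      P, since its dual has a nonzero P-fixed vector; the image again contains a
      nonzero P-fixed vector, and such vectors for nonisomorphic modules are
      linearly independent functions on P\G/P, so there are at most |P\G/P|
      irreducible modules;
    - for a p'-element x and a Sylow p-subgroup Q of C_G(x), left multiplication
      by x^-1 commutes with G on the functions on Q\G, and the trace of its
      product with a p'-element g is |C_G(x) : Q| or 0 according to whether g is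
      conjugate to x. Splitting into eigenspaces makes this trace a combination
      of traces of irreducible modules, so these traces separate the p'-classes
      linearly and there are at least k_{p'}(G) irreducible modules.
    If P is not normal then |G : N_G(P)| >= p + 1 by Sylow's theorem, so P fixes
    at most |G : P| / (p + 1) of its right cosets and moves the others in orbits
    of length at least p; hence |P\G/P| <= 2 |G : P| / (p + 1). *)

Set Implicit Arguments. Unset Strict Implicit. Unset Printing Implicit Defensive.
Import GroupScope GRing.Theory.
Local Open Scope ring_scope.

(** * Cosets fixed by a two-sided translation *)

(** Fixing [Q :* t] means that q = x^-1 g^(t^-1) lies in Q. Such a q is a p-element commuting with
    x, hence also a product of the commuting p'-elements x^-1 and x q; so q = 1. *)
Lemma rcoset_twisted_fix (gT : finGroupType) (Q : {group gT}) (p : nat) x g t :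
    Q \subset 'C[x] -> p.-group Q -> p^'.-elt x -> p^'.-elt g ->
  ((x^-1 *: (Q :* t)) :* g == Q :* t)%g = (x ^ t == g)%g.
Proof.
move=> cxQ pQ p'x p'g; pose q := (x^-1 * (g ^ t^-1))%g.
have xQ : (x^-1 *: Q = Q :* x^-1)%g.
  rewrite norm_rlcoset // groupV (subsetP (cent_sub Q)) //.
  by rewrite -sub_cent1.
have -> : ((x^-1 *: (Q :* t)) :* g == Q :* t)%g = (q \in Q).
  rewrite mulgA xQ -!rcosetM (sameP eqP rcoset_eqP) mem_rcoset.
  by rewrite /q conjgE invgK !mulgA.
rewrite (canF_eq (conjgK t)); apply/idP/eqP=> [Qq | x_g]; last first.
  by rewrite /q -x_g mulVg.
have cxq : commute x q by apply/commute_sym/cent1P/(subsetP cxQ).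
have def_g : (g ^ t^-1 = x * q)%g by rewrite /q mulKVg.
have p'q : p^'.-elt q.
  rewrite -(mulKg x q); apply: p_eltM; rewrite ?p_eltV -?def_g ?p_eltJ //.
  by rewrite def_g; apply/commute_sym/commuteV/commute_sym/commuteM.
have /eqP : q = 1%g.
  by apply/eqP; rewrite -order_eq1 (pnat_1 (mem_p_elt pQ Qq) p'q).
by rewrite -eq_invg_mul invgK => /eqP.
Qed.

(** If g = x^t, the fixed cosets are the translates by t of the cosets of Q in C_G(x). *)
Lemma card_rcosets_twisted_fix (gT : finGroupType) (G Q : {group gT}) (p : nat) x g :
    p.-group Q -> Q \subset 'C_G[x] -> p^'.-elt x -> p^'.-elt g ->
  #|[set w in rcosets Q G | (x^-1 *: w) :* g == w]%g|
    = ((g \in x ^: G) * #|'C_G[x] : Q|)%N.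
Proof.
move=> pQ sQC p'x p'g; have /subsetIP[sQG cxQ] := sQC.
have fixE t := rcoset_twisted_fix t cxQ pQ p'x p'g.
have [/imsetP[t Gt def_g] | xG'g] := boolP (g \in x ^: G); last first.
  apply/eqP; rewrite mul0n cards_eq0; apply/eqP/setP=> w; rewrite !inE.
  apply/negP=> /andP[/rcosetsP[t Gt ->]]; rewrite fixE => /eqP def_g.
  by rewrite -def_g memJ_class in xG'g.
rewrite mul1n -[RHS](card_imset _ (@rcoset_inj _ t)); apply: eq_card => w.
rewrite inE; apply/andP/imsetP=> [[/rcosetsP[s Gs ->]] | [_ /rcosetsP[c Cc ->] ->]].
  rewrite fixE def_g => /eqP xs_xt; exists (Q :* (s * t^-1)%g).
    apply/rcosetsP; exists (s * t^-1)%g => //; rewrite inE groupM ?groupV //=.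
    by apply/cent1P/commute_sym/commgP/conjg_fixP; rewrite conjgM xs_xt conjgK.
  by rewrite -rcosetM mulgKV.
have /setIP[Gc /cent1P/commute_sym/commgP/conjg_fixP xc] := Cc.
rewrite -rcosetM fixE conjgM xc def_g mem_rcosets; split=> //.
by rewrite mulSGid // groupM.
Qed.

(** * Permutation modules and traces *)

Section ActionRepresentation.

Variables (F : fieldType) (gT : finGroupType) (T : finType).
Variables (to : {action gT &-> T}) (G : {group gT}).

Definition act_mx (x : gT) : 'M[F]_#|T| :=
  \matrix_(i, j) (j == enum_rank (to (enum_val i) x))%:R.

Lemma mul_act_mx m (A : 'M_(m, #|T|)) x i w :
  (A *m act_mx x) i (enum_rank (to w x)) = A i (enum_rank w).
Proof.
rewrite mxE (bigD1 (enum_rank w)) //= mxE enum_rankK eqxx mulr1.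
rewrite big1 ?addr0 // => j ne_jw; rewrite mxE (inj_eq enum_rank_inj).
rewrite (inj_eq (act_inj to x)) -{1}(enum_rankK w).
by rewrite (inj_eq enum_val_inj) eq_sym (negPf ne_jw) mulr0.
Qed.

Lemma act_mx_repr : mx_repr G act_mx.
Proof.
split=> [|x y _ _]; apply/matrixP=> i j.
  by rewrite !mxE act1 enum_valK eq_sym.
rewrite -[j]enum_valK -[enum_val j](actKV to y) mul_act_mx !mxE.
rewrite !(inj_eq enum_rank_inj) actM; congr (nat_of_bool _)%:R.
by rewrite -[RHS](inj_eq (act_inj to y)).
Qed.

Definition act_repr := MxRepresentation act_mx_repr.

(** Zero rows outside [D] later confine a translation of [{set gT}] to the cosets of one
    subgroup. *)
Definition partial_fun_mx (D : pred T) (h : T -> T) : 'M[F]_#|T| :=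
  \matrix_(i, j) (D (enum_val i) && (enum_val j == h (enum_val i)))%:R.

Lemma partial_fun_mx_cent (D : pred T) (h : T -> T) :
    {in G, forall x w, D (to w x) = D w} ->
    {in G, forall x w, h (to w x) = to (h w) x} ->
  centgmx act_repr (partial_fun_mx D h).
Proof.
move=> DG hG; apply/centgmxP=> x Gx; apply/matrixP=> i j.
rewrite -[j]enum_valK -[enum_val j](actKV to x) mul_act_mx !mxE.
rewrite (bigD1 (enum_rank (to (enum_val i) x))) //= big1 => [|k ne_k]; last first.
  by rewrite mxE (negPf ne_k) mul0r.
rewrite addr0 !mxE eqxx mul1r !enum_rankK DG // hG //.
by rewrite (inj_eq (act_inj to x)).
Qed.

Lemma mxtrace_partial_fun_act (D : pred T) (h : T -> T) x :
  \tr (partial_fun_mx D h *m act_mx x)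
    = #|[set w | D w & to (h w) x == w]|%:R.
Proof.
rewrite -[in RHS]sum1_card natr_sum big_mkcond.
rewrite [RHS](reindex (enum_val : 'I_#|T| -> T)) /=; last first.
  by apply: onW_bij; apply: enum_val_bij.
apply: eq_bigr => i _.
have {2}-> : i = enum_rank (to (to (enum_val i) x^-1%g) x).
  by rewrite actKV enum_valK.
rewrite mul_act_mx mxE !enum_rankK inE.
rewrite -(inj_eq (act_inj to x) (to _ x^-1%g)) actKV eq_sym.
by case: ifP; rewrite ?mulr1n ?mulr0n.
Qed.

End ActionRepresentation.

(** * Irreducible modules as functions on cosets *)

Section PModular.

Variables (F : fieldType) (p : nat) (gT : finGroupType).
Hypothesis pcharFp : p \in [pchar F].

(** A p-group fixes a nonzero row of the dual representation [rD]; its transpose is the required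
    column. *)
Lemma pgroup_fixed_col n (G P : {group gT}) (rG : mx_representation F G n) :
    (n > 0)%N -> p.-group P -> P \subset G ->
  exists2 u : 'cV_n, u != 0 & {in P, forall y, rG y *m u = u}.
Proof.
move=> n_gt0 pP sPG.
have dual_repr : mx_repr G (fun x => (rG x^-1%g)^T).
  split=> [|x y Gx Gy]; first by rewrite invg1 repr_mx1 trmx1.
  by rewrite invMg repr_mxM ?groupV // trmx_mul.
pose rD := MxRepresentation dual_repr.
have := rfix_pgroup_pchar pcharFp rD n_gt0 pP sPG.
rewrite -nz_row_eq0; set v := nz_row _ => nz_v.
have /rfix_mxP fixv : (v <= rfix_mx rD P)%MS by apply: nz_row_sub.
exists v^T => [|y Py]; first by rewrite -(inj_eq trmx_inj) trmxK trmx0.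
by apply: trmx_inj; rewrite trmx_mul trmxK -[RHS](fixv y^-1%g) ?groupV //= invgK.
Qed.

Lemma irr_hom_row_free n m (G : {group gT}) (rG : mx_representation F G n)
    (rH : mx_representation F G m) (B : 'M_(n, m)) :
    mx_irreducible rG -> {in G, forall x, rG x *m B = B *m rH x} -> B != 0 ->
  row_free B.
Proof.
case/mx_irrP=> _ minG homB nzB; rewrite -kermx_eq0; apply: contraR nzB => nzK.
have modK : mxmodule rG (kermx B).
  apply/mxmoduleP=> x Gx; apply/sub_kermxP.
  by rewrite -mulmxA homB // mulmxA mulmx_ker mul0mx.
have := minG _ modK nzK; rewrite -sub1mx => /sub_kermxP.
by rewrite mul1mx => ->.
Qed.

Lemma mx_rsim_image n m (G : {group gT}) (rG : mx_representation F G n)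
    (rH : mx_representation F G m) (B : 'M_(n, m)) :
    row_free B -> {in G, forall x, rG x *m B = B *m rH x} ->
  exists modB : mxmodule rH <<B>>%MS, mx_rsim rG (submod_repr modB).
Proof.
move=> freeB homB; have modB : mxmodule rH <<B>>%MS.
  rewrite (eqmx_module _ (genmxE B)); apply/mxmoduleP=> x Gx.
  by rewrite -homB // submxMl.
have sB : (B <= <<B>>)%MS by rewrite genmxE.
exists modB, (in_submod <<B>>%MS B) => [||x Gx].
- by rewrite genmxE (eqP freeB).
- by rewrite /row_free mxrank_in_submod.
rewrite -in_submodJ // -homB //; exact: mulmxA.
Qed.

(* Functions on all of [{set gT}] are used, so that the right cosets of every
   subgroup live in a single module. *)
Lemma irr_embed_rcosets n (G P : {group gT}) (rG : mx_representation F G n) :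
    mx_irreducible rG -> p.-group P -> P \subset G ->
  exists B : 'M_(n, #|{set gT}|),
    [/\ row_free B, {in G, forall x, rG x *m B = B *m act_mx F 'Rs%act x}
      & forall i w, w \notin rcosets P G -> B i (enum_rank w) = 0].
Proof.
move=> irrG pP sPG; have [n_gt0 _] := (mx_irrP _).1 irrG.
have [u nz_u fixu] := pgroup_fixed_col rG n_gt0 pP sPG.
(* A row s is sent to the function with value s t^-1 u at P t; as P fixes u, any representative of
   the coset will do. *)
pose b (w : {set gT}) : 'cV_n :=
  if w \in rcosets P G then rG (repr w)^-1%g *m u else 0.
pose B : 'M_(n, #|{set gT}|) := \matrix_(i, j) b (enum_val j) i 0.
have bE t : t \in G -> b (P :* t) = rG t^-1%g *m u.
  move=> Gt; rewrite /b mem_rcosets mulSGid // Gt.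
  case: repr_rcosetP => y Py.
  have Gy := subsetP sPG y Py.
  by rewrite invMg repr_mxM ?groupV // -mulmxA fixu ?groupV.
have homB : {in G, forall x, rG x *m B = B *m act_repr F 'Rs%act G x}.
  move=> x Gx; apply/matrixP=> i j.
  rewrite -[j]enum_valK -[enum_val j](actKV 'Rs%act x) mul_act_mx.
  set w := 'Rs%act (enum_val j) x^-1%g; rewrite !mxE !enum_rankK.
  under eq_bigr => k _ do rewrite mxE enum_rankK.
  have -> : b ('Rs%act w x) = rG x^-1%g *m b w.
    have [/rcosetsP[t Gt ->] | Pw] := boolP (w \in rcosets P G).
      rewrite /= !rcosetE -rcosetM !bE ?groupM // invMg.
      by rewrite repr_mxM ?groupV ?mulmxA.
    rewrite /b (negPf Pw) mulmx0 ifN //; apply: contra Pw => /rcosetsP[t Gt].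
    rewrite /= rcosetE => def_t; apply/rcosetsP; exists (t * x^-1)%g.
      by rewrite groupM ?groupV.
    by rewrite rcosetM -def_t -rcosetM mulgV rcoset1.
  have -> : b w i 0 = (rG x *m (rG x^-1%g *m b w)) i 0.
    by rewrite mulmxA -repr_mxM ?groupV // mulgV repr_mx1 mul1mx.
  by rewrite [RHS]mxE.
exists B; split=> // [|i w Pw]; last by rewrite mxE enum_rankK /b (negPf Pw) mxE.
(* [B] is nonzero because its column at the coset [P] is [u]. *)
apply: (irr_hom_row_free irrG homB); apply: contraNneq nz_u => B0.
have <- : b P = u by rewrite -[P : {set _}]rcoset1 bE // invg1 repr_mx1 mul1mx.
apply/eqP/matrixP=> i j; rewrite ord1 mxE.
have := congr1 (fun M : 'M_(n, _) => M i (enum_rank (P : {set _}))) B0.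
by rewrite !mxE enum_rankK.
Qed.

(** Taking P trivial embeds every irreducible module in the module of ['Rs], so the components in
    [sG] stand for all irreducible modules of G. *)
Lemma irr_rsim_socle n (G : {group gT}) (rG : mx_representation F G n)
    (sG : socleType (act_repr F 'Rs%act G)) :
  mx_irreducible rG -> exists W : sG, mx_rsim rG (socle_repr W).
Proof.
move=> irrG.
have [B [freeB homB _]] := irr_embed_rcosets irrG (pgroup1 gT p) (sub1G G).
have [modB simB] := mx_rsim_image (rH := act_repr F 'Rs%act G) freeB homB.
have /(submod_mx_irr modB)/(Socle_iso sG)[W isoWB] := mx_rsim_irr simB irrG.
exists W; apply: mx_rsim_trans simB (mx_rsim_sym _).
exact/(mx_rsim_iso (socle_module W) modB).
Qed.

End PModular.

(** * Counting irreducible modules over an algebraically closed field *)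

Section ClosedField.

Variables (F : closedFieldType) (p : nat) (gT : finGroupType) (G : {group gT}).
Hypothesis pcharFp : p \in [pchar F].
Variable sG : socleType (act_repr F 'Rs%act G).

(* By induction on the dimension: [X] is a scalar on any simple submodule [M] of an
   eigenspace, and it acts on the quotient by [M]. *)
Lemma trace_cent_span n (rG : mx_representation F G n) (X : 'M_n) :
    centgmx rG X ->
  exists c : sG -> F,
    {in G, forall x, \tr (X *m rG x) = \sum_W c W * \tr (socle_repr W x)}.
Proof.
elim/ltn_ind: n => n IHn in rG X *; move=> cGX.
have [n0 | n_gt0] := posnP n.
  exists (fun _ => 0) => x _; rewrite big1 => [|W _]; last by rewrite mul0r.
  by rewrite /mxtrace big1 // => i; have := ltn_ord i; rewrite [X in (_ < X)%N]n0.
have [a] : {a | root (char_poly X) a}.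
  by apply/sigW/closed_rootP; rewrite size_char_poly eqSS -lt0n.
rewrite -eigenvalue_root_char => eig_a.
have cGXa : centgmx rG (X - a%:M).
  apply/centgmxP=> x Gx; rewrite mulmxBl mulmxBr scalar_mxC.
  by rewrite (centgmxP cGX).
have [M simM sMK] := dec_mxsimple_exists (kermx_centg_module cGXa) eig_a.
have [modM nzM _] := simM.
have XM m (W : 'M_(m, n)) : (W <= M)%MS -> W *m X = a *: W.
  move=> sWM; apply/eigenspaceP; exact: submx_trans sWM sMK.
(* The map induced by X on the quotient by M, well defined since X is scalar on M. *)
pose X' := in_factmod M (val_factmod (U := M) 1%:M *m X).
have inX m (W : 'M_(m, n)) : in_factmod M (W *m X) = in_factmod M W *m X'.
  rewrite -{1}[W](add_sub_fact_mod M) mulmxDl linearD /= XM ?val_submodP //.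
  rewrite linearZ /=.
  have /eqP-> : in_factmod M (val_submod (in_submod M W)) == 0.
    by rewrite in_factmod_eq0 val_submodP.
  rewrite scaler0 add0r /X' /in_factmod /val_factmod /= !mulmxA.
  by rewrite mulmx1.
have ltMn : (\rank (cokermx M) < n)%N.
  by rewrite mxrank_coker ltn_subrL n_gt0 lt0n mxrank_eq0 nzM.
have [|c' c'P] := IHn _ ltMn (factmod_repr modM) X'.
  apply/centgmxP=> x Gx; rewrite /= -in_factmodJ // -mulmxA (centgmxP cGX) //.
  by rewrite mulmxA inX.
have [W0 simW0] := irr_rsim_socle pcharFp sG ((submod_mx_irr modM).2 simM).
(* M adds its eigenvalue to the coefficient of its own isomorphism type; the quotient supplies the
   rest. *)
exists (fun W => a *+ (W == W0) + c' W) => x Gx.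
under eq_bigr => W _ do rewrite mulrDl.
rewrite big_split /= -c'P // (bigD1 W0) //= eqxx mulr1n big1 ?addr0; last first.
  by move=> W /negPf->; rewrite mulr0n mul0r.
rewrite -(mxtrace_rsim simW0) //.
rewrite -[X *m _](add_sub_fact_mod M) mxtraceD; congr (_ + _).
  rewrite val_submodE mxtrace_mulC.
  have -> : val_submod (U := M) 1%:M *m in_submod M (X *m rG x)
            = in_submod M (val_submod (U := M) 1%:M *m (X *m rG x)) by exact: mulmxA.
  by rewrite (mulmxA _ X) XM ?val_submod1 // -scalemxAl linearZ mxtraceZ.
rewrite val_factmodE mxtrace_mulC.
have -> : val_factmod (U := M) 1%:M *m in_factmod M (X *m rG x)
          = in_factmod M (val_factmod (U := M) 1%:M *m (X *m rG x)) by exact: mulmxA.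
by rewrite (mulmxA _ X) in_factmodJ.
Qed.

(** The fixed-coset count is |C_G(x) : Q| times the class indicator, and this index is invertible in
    F because Q is Sylow in C_G(x). *)
Lemma p'elt_class_span x : x \in G -> p^'.-elt x ->
  exists c : sG -> F, {in G, forall g, p^'.-elt g ->
    \sum_W c W * \tr (socle_repr W g) = (g \in x ^: G)%:R}.
Proof.
move=> Gx p'x; have [Q /and3P[sQC pQ p'CQ]] := Sylow_exists p 'C_G[x].
have nz_CQ : #|'C_G[x] : Q|%:R != 0 :> F.
  rewrite -(dvdn_pcharf pcharFp) -prime_coprime ?(pcharf_prime pcharFp) //.
  by rewrite (pnat_coprime (pnat_id (pcharf_prime pcharFp)) p'CQ).
pose D (w : {set gT}) := w \in rcosets Q G.
pose h (w : {set gT}) := (x^-1 *: w)%g.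
have [|c cP] := trace_cent_span (rG := act_repr F 'Rs%act G)
                                 (X := partial_fun_mx F D h).
  apply: partial_fun_mx_cent => y Gy w; last by rewrite /h /= !rcosetE mulgA.
  rewrite /D /= rcosetE; apply/rcosetsP/rcosetsP=> [] [t Gt def_t].
    exists (t * y^-1)%g; first by rewrite groupM ?groupV.
    by rewrite rcosetM -def_t rcosetK.
  by exists (t * y)%g; rewrite ?groupM // rcosetM def_t.
exists (fun W => #|'C_G[x] : Q|%:R^-1 * c W) => g Gg p'g.
under eq_bigr => W _ do rewrite -mulrA.
rewrite -mulr_sumr -cP // mxtrace_partial_fun_act.
rewrite (eq_card (B := [set w in rcosets Q G | (x^-1 *: w) :* g == w]%g)); last first.
  by move=> w; rewrite !inE /= rcosetE.
by rewrite (card_rcosets_twisted_fix pQ) // natrM mulrCA mulVf ?mulr1.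
Qed.

Lemma kpprime_le_socle : (kpprime p G <= #|sG|)%N.
Proof.
rewrite /kpprime; set S := [set _ in _ | _].
pose r (i : 'I_#|S|) := repr (enum_val i).
have rP i : [/\ r i \in G, p^'.-elt (r i) & r i ^: G = enum_val i].
  have := enum_valP i; rewrite inE /r => /andP[/imsetP[y Gy ->] p'r].
  have yr : repr (y ^: G) \in y ^: G by apply: mem_repr (class_refl G y).
  by split=> //; [apply: subsetP (class_subG Gy (subxx G)) _ yr | apply: class_eqP].
have [c cP] := fin_all_exists (fun i =>
  let: And3 Gr p'r _ := rP i in p'elt_class_span Gr p'r).
pose A := \matrix_(i < #|S|, j < #|sG|) c i (enum_val j).
pose B := \matrix_(j < #|sG|, k < #|S|) \tr (socle_repr (enum_val j : sG) (r k)).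
(* An identity matrix of size |S| that factors through dimension |sG| forces |S| <= |sG|. *)
apply: (@mulmx1_min _ _ _ A B); apply/matrixP=> i k; rewrite !mxE.
have [[Gk p'k def_k] [_ _ def_i]] := (rP k, rP i).
under eq_bigr => j _ do rewrite !mxE.
rewrite -(big_enum_val (fun W : sG => c i W * \tr (socle_repr W (r k)))) /=.
rewrite cP // (sameP class_eqP eqP) def_k def_i.
by rewrite (inj_eq enum_val_inj) eq_sym.
Qed.

Lemma socle_pgroup_fixed (P : {group gT}) (W : sG) : p.-group P -> P \subset G ->
  exists v : 'rV_#|{set gT}|,
    [/\ v != 0, (v <= W)%MS, {in P, forall y, v *m act_mx F 'Rs%act y = v}
      & forall w, w \notin rcosets P G -> v 0 (enum_rank w) = 0].
Proof.
move=> pP sPG; have irrW := socle_irr W.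
have [B [freeB homB supB]] := irr_embed_rcosets pcharFp irrW pP sPG.
have [modB simB] := mx_rsim_image (rH := act_repr F 'Rs%act G) freeB homB.
have [n_gt0 _] := (mx_irrP _).1 irrW.
have := rfix_pgroup_pchar pcharFp (socle_repr W) n_gt0 pP sPG.
rewrite -nz_row_eq0; set s := nz_row _ => nz_s.
have /rfix_mxP fixs : (s <= rfix_mx (socle_repr W) P)%MS by apply: nz_row_sub.
exists (s *m B); split=> [||y Py|w Pw].
- by apply: contraNneq nz_s => sB0; apply/eqP/(row_free_inj freeB); rewrite mul0mx.
(* The image of B is isomorphic to the simple module of W, hence lies in the isotypic component. *)
- have sBW : (<<B>> <= W)%MS.
    apply: mx_iso_component (socle_simple W) _ _.
    exact/(mx_rsim_iso (socle_module W) modB).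
  by apply: submx_trans (submxMl s B) _; rewrite genmxE in sBW.
- by rewrite -mulmxA -homB ?(subsetP sPG) // mulmxA fixs.
by rewrite mxE big1 // => i _; rewrite supB ?mulr0.
Qed.

Lemma socle_le_orbits (P : {group gT}) : p.-group P -> P \subset G ->
  (#|sG| <= #|orbit 'Rs P @: rcosets P G|)%N.
Proof.
move=> pP sPG; set O := _ @: _.
have [v vP] := fin_all_exists (fun W : sG => socle_pgroup_fixed W pP sPG).
pose o (k : 'I_#|O|) := repr (enum_val k).
(* A P-fixed function supported on the cosets is determined by its values at one coset from each
   orbit. *)
pose A := \matrix_(i < #|sG|, k < #|O|) v (enum_val i) 0 (enum_rank (o k)).
suffices /eqP <- : row_free A by apply: rank_leq_col.
rewrite -kermx_eq0; apply/rowV0P=> u /sub_kermxP uA0.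
pose x := \sum_W u 0 (enum_rank W) *: v W.
have fix_x : {in P, forall y, x *m act_mx F 'Rs%act y = x}.
  move=> y Py; rewrite mulmx_suml; apply: eq_bigr => W _.
  by rewrite -scalemxAl; have [_ _ -> //] := vP W.
have x0 : x = 0.
  apply/rowP=> j; rewrite mxE -[j]enum_valK; set w := enum_val j.
  have [Pw | notPw] := boolP (w \in rcosets P G); last first.
    rewrite summxE big1 // => W _; have [_ _ _ supv] := vP W.
    by rewrite mxE supv ?mulr0.
  have Ow : orbit 'Rs P w \in O by apply: imset_f.
  pose k := enum_rank_in Ow (orbit 'Rs P w).
  have /orbitP[y Py def_o] : o k \in orbit 'Rs P w.
    by rewrite /o enum_rankK_in //; apply: mem_repr (orbit_refl _ _ _).
  rewrite -(mul_act_mx 'Rs x y) fix_x // def_o.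
  have <- : (u *m A) 0 k = x 0 (enum_rank (o k)); last by rewrite uA0 mxE.
  rewrite mxE summxE (reindex (enum_rank : sG -> _)) /=; last first.
    by apply: onW_bij; apply: enum_rank_bij.
  by apply: eq_bigr => W _; rewrite !mxE enum_rankK.
(* The [v W] lie in different isotypic components, whose sum is direct, so every term of the
   vanishing sum is zero. *)
have [z _ _ uniq_z] := sub_dsumsmx (Socle_direct sG) (sub0mx 1 _).
have uv0 W : u 0 (enum_rank W) *: v W = 0.
  rewrite (uniq_z _ _ (esym x0)) // => [|W' _]; last first.
    by rewrite scalemx_sub //; have [] := vP W'.
  by rewrite -(uniq_z (fun _ => 0)) // => [W' _|]; rewrite ?sub0mx ?big1.
apply/rowP=> i; rewrite mxE -[i]enum_valK; apply/eqP; move/eqP: (uv0 (enum_val i)).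
by rewrite scalemx_eq0; have [/negPf-> _ _ _] := vP (enum_val i); rewrite orbF.
Qed.

End ClosedField.

(** * The double coset bound *)

Lemma pchar_closedField_exists p : prime p -> {F : closedFieldType | p \in [pchar F]}.
Proof.
move=> p_pr; have [F [f _]] := countable_algebraic_closure 'F_p.
by exists F; rewrite (fmorph_pchar f) pchar_Fp.
Qed.

(** The P-orbits on the right cosets of P are the double cosets in P\G/P. *)
Lemma kpprime_le_double_cosets (gT : finGroupType) (G P : {group gT}) p :
    prime p -> p.-group P -> P \subset G ->
  (kpprime p G <= #|orbit 'Rs P @: rcosets P G|)%N.
Proof.
move=> p_pr pP sPG; have [F pcharFp] := pchar_closedField_exists p_pr.
have sG := DecSocleType (act_repr F 'Rs%act G).
exact: leq_trans (kpprime_le_socle pcharFp sG) (socle_le_orbits pcharFp sG pP sPG).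
Qed.

(** * Counting the orbits of a Sylow subgroup on its cosets *)

(** Orbit lengths are powers of p, so each orbit o satisfies p <= |o| + (p - 1) [|o| = 1]; sum over
    the orbits, the singletons being fixed points. *)
Lemma pgroup_card_orbits_le (aT : finGroupType) (sT : finType) (to : {action aT &-> sT})
    (p : nat) (P : {group aT}) (S : {set sT}) :
    prime p -> p.-group P -> [acts P, on S | to] ->
  (p * #|orbit to P @: S| <= #|S| + p.-1 * #|'Fix_(S | to)(P)|)%N.
Proof.
move=> p_pr pP actsP; set O := _ @: S.
rewrite -(acts_sum_card_orbit actsP) -/O.
have fixO : (#|[set o in O | #|o| == 1%N]| <= #|'Fix_(S | to)(P)|)%N.
  rewrite -(card_imset _ (@set1_inj sT)) subset_leq_card //.
  apply/subsetP=> o; rewrite inE => /andP[/imsetP[w Sw ->]].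
  move=> /cards1P[w' def_o]; apply/imsetP; exists w; last first.
    by apply/eqP; rewrite eq_sym eqEcard sub1set orbit_refl def_o !cards1.
  rewrite inE Sw; apply/orbit1P/eqP.
  by rewrite eq_sym eqEcard sub1set orbit_refl def_o !cards1.
have /leq_trans-> // :
    (p * #|O| <= \sum_(o in O) #|o| + p.-1 * #|[set o in O | #|o| == 1%N]|)%N;
  last by rewrite leq_add2l leq_mul2l fixO orbT.
have -> : #|[set o in O | #|o| == 1%N]| = (\sum_(o in O) (#|o| == 1))%N.
  rewrite -sum1_card (eq_bigl (fun o => (o \in O) && (#|o| == 1%N))) => [|o].
    by rewrite big_mkcondr; apply: eq_bigr => o _; case: eqP.
  by rewrite inE.
rewrite mulnC -sum_nat_const big_distrr -big_split /=.
apply: leq_sum => _ /imsetP[w Sw ->].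
have /p_natP[k ->] : p.-nat #|orbit to P w| := pnat_dvd (dvdn_orbit to P w) pP.
case: k => [|k]; first by rewrite expn0 muln1 add1n prednK ?prime_gt0.
by rewrite expnS (leq_trans _ (leq_addr _ _)) // leq_pmulr ?expn_gt0 ?prime_gt0.
Qed.

Lemma Sylow_double_cosets_le (gT : finGroupType) (G P : {group gT}) (p : nat) :
    prime p -> p.-Sylow(G) P -> ~~ (P <| G) ->
  (p.+1 * #|orbit 'Rs P @: rcosets P G| <= 2 * #|G : P|)%N.
Proof.
move=> p_pr sylP nPG; have [sPG pP _] := and3P sylP.
have actsP := subset_trans sPG (actsRs_rcosets P G).
have := pgroup_card_orbits_le p_pr pP actsP.
(* P fixes the coset P t exactly when t normalises P, so |N_G(P) : P| cosets are fixed. *)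
rewrite afixRs_rcosets -/(#|G : P|)%g -/(#|'N_G(P) : P|)%g => leO.
have leN : (p.+1 * #|'N_G(P) : P| <= #|G : P|)%N.
  have sPN : P \subset 'N_G(P) by rewrite subsetI sPG normG.
  rewrite -(Lagrange_index (subsetIl G 'N(P)) sPN) leq_pmul2r ?indexg_gt0 //.
  have := card_Syl_mod G p_pr; rewrite (card_Syl sylP) => modN.
  have N_gt1 : (1 < #|G : 'N_G(P)|)%N.
    rewrite ltn_neqAle indexg_gt0 eq_sym indexg_eq1 andbT subsetI subxx /=.
    by apply: contra nPG; rewrite /normal sPG.
  rewrite (divn_eq #|G : 'N_G(P)| p) modN addn1 ltnS leq_pmull //.
  rewrite divn_gt0 ?prime_gt0 // leqNgt; apply: contraL N_gt1 => ltNp.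
  by rewrite -modN modn_small // ltnn.
(* With N = |N_G(P) : P|, (p + 1)(|G : P| + (p - 1) N) <= (p + 1) |G : P| + (p - 1) |G : P| = 2 p |G
   : P|, and p cancels. *)
have p_gt0 := prime_gt0 p_pr; rewrite -(leq_pmul2l p_gt0) mulnCA.
apply: leq_trans (leq_mul (leqnn p.+1) leO) _.
rewrite mulnDr mulnCA.
apply: leq_trans (leq_add (leqnn _) (leq_mul (leqnn p.-1) leN)) _.
by rewrite -mulnDl addSnnS prednK // addnn -mul2n -mulnA mulnCA.
Qed.

Theorem theorem1p3 (gT : finGroupType) (G : {group gT}) (p : nat) :
  prime p ->
  (2%:R / (p.+1)%:R < dpprime p G)%R ->
  exists2 P : {group gT}, (P \in 'Syl_p(G))%g & (P <| G)%g.
Proof.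
move=> p_pr d_gt; have [P sylP] := Sylow_exists p G.
exists P; first by rewrite inE.
have [sPG pP _] := and3P sylP; apply: contraLR d_gt => nPG.
rewrite -Order.TotalTheory.leNgt.
have G_gt0 : (0 < #|G|`_p^')%N by apply: part_gt0.
rewrite /dpprime Num.Theory.ler_pdivrMr ?Num.Theory.ltr0n // mulrAC.
rewrite Num.Theory.ler_pdivlMr ?Num.Theory.ltr0n //.
rewrite -!natrM Num.Theory.ler_nat mulnC.
have <- : #|G : P| = (#|G|`_p^')%N.
  by apply/eqP; rewrite -(eqn_pmul2l (cardG_gt0 P)) Lagrange // (card_Hall sylP) partnC.
apply: leq_trans (Sylow_double_cosets_le p_pr sylP nPG).
by rewrite leq_mul2l kpprime_le_double_cosets.
Qed.
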